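(* Let $m,n,\ell\ge0$ be integers such that $n+\ell\ge m$, and let $N\ge0$. Let $\theta=f^{\ell+1}$. Then for every $\lambda\in\overline{\mathcal R}_{m,n}^{\ge 1-\ell}(N)$, \[\theta(\lambda)=\phi\bigl(\gamma^{\ell+1}(\phi^{-1}(\lambda'))\bigr)',\] where $'$ denotes conjugation of partitions. That is, the following diagram of bijections (where $\mathrm{conj}$ is conjugation) commutes: \[ \begin{array}{ccccc} \overline{\mathcal R}_{m,n}^{\ge 1-\ell}(N)&\stackrel{\mathrm{conj}}{\longleftrightarrow}& \overline{\mathcal R}_{n,m}^{\le \ell-1}(N)&\stackrel{\phi^{-1}}{\longrightarrow}& \overline{\mathcal A}_{n,m}^{-\ell}(N)\\ \downarrow \theta &&&&\downarrow \gamma^{\ell+1}\\ \mathcal P_{m-\ell-1,n+\ell+1}(N-\ell-1)&\stackrel{\mathrm{conj}}{\longleftrightarrow}&\mathcal P_{n+\ell+1,m-\ell-1}(N-\ell-1)&\stackrel{\phi^{-1}}{\longrightarrow}&\mathcal G_{n+\ell+1,m-\ell-1}(N-\ell-1) \end{array} \]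
   Context: Partitions. A partition $\lambda=(\lambda_1\ge\dots\ge\lambda_k)$ is a weakly decreasing (possibly empty) sequence of positive integers; $|\lambda|=\sum_i\lambda_i$; $\lambda_i=0$ for $i>k$; its conjugate $\lambda'$ has parts $\lambda'_j=|\{i:\lambda_i\ge j\}|$. Let $d(\lambda)=\max\{i\ge1:\lambda_i\ge i\}$ ($0$ if $\lambda=\emptyset$). For $1\le i\le d(\lambda)$ the $i$th successive rank is $r_i(\lambda)=\lambda_i-\lambda'_i$. $\mathcal P_{a,b}$ is the set of partitions with at most $a$ parts and largest part at most $b$ (empty if $a<0$ or $b<0$). $\overline{\mathcal R}^{\ge c}$ (resp. $\overline{\mathcal R}^{\le c}$) is the set of partitions having at least one rank $<c$ (resp. $>c$), and $\overline{\mathcal R}^{\ast}_{a,b}=\overline{\mathcal R}^{\ast}\cap\mathcal P_{a,b}$. Appending $(N)$ to a set of partitions means restricting to $|\lambda|=N$. The map $f$. For $\lambda$ with some rank $\le0$, let $i$ be the largest index in $\{1,\dots,d(\lambda)\}$ minimizing $r_i(\lambda)$. Remove one part of size $i$ from $\lambda$ (it exists); then insert a part of size $i-1$ into the conjugate of the resulting partition (nothing if $i=1$). The result is $f(\lambda)$. Powers such as $f^{\ell+1}$ and $\gamma^{\ell+1}$ denote iterates. Words, partitions and paths. $\mathcal W_{a,b}$ is the set of words with $a$ letters $1$ and $b$ letters $2$. A partition $\lambda=(\lambda_1,\dots,\lambda_k)\in\mathcal P_{a,b}$ is identified with the word $1^{a-k}2^{\lambda_k}12^{\lambda_{k-1}-\lambda_k}1\cdots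 12^{\lambda_1-\lambda_2}12^{b-\lambda_1}\in\mathcal W_{a,b}$ (the south-east boundary of the Young diagram in an $a\times b$ box read from lower-left to upper-right, $1$ = vertical, $2$ = horizontal). $\mathcal G_{a,b}$ is the set of lattice paths from the origin with $a$ steps $U=(1,1)$ and $b$ steps $D=(1,-1)$ (empty if $a<0$ or $b<0$); it is identified with $\mathcal W_{a,b}$ by $1\leftrightarrow U$, $2\leftrightarrow D$. A valley of a path is a vertex preceded by $D$ and followed by $U$; $\mathrm{maj}(P)$ is the sum of the $x$-coordinates of the valleys. $\overline{\mathcal A}^{c}_{a,b}$ is the set of $P\in\mathcal G_{a,b}$ having some vertex strictly below the line $y=c$. Appending $(N)$ to a set of paths means restricting to $\mathrm{maj}(P)=N$. Foata's bijection $\phi:\mathcal W_{a,b}\to\mathcal W_{a,b}$ is defined recursively by $\phi(\epsilon)=\epsilon$ ($\epsilon$ the empty word), $\phi(1)=1$, $\phi(w2)=\phi(w)2$, $\phi(w11)=1\phi(w1)$, $\phi(w21)=2\phi(w)1$. Via the identifications above, it is viewed as a bijection $\phi:\mathcal G_{a,b}\to\mathcal P_{a,b}$ with inverse $\phi^{-1}:\mathcal P_{a,b}\to\mathcal G_{a,b}$. In the claim, $\lambda'\in\mathcal P_{n,m}$, so $\phi^{-1}(\lambda')\in\mathcal G_{n,m}$; the outer $\phi$ goes from $\mathcal G_{n+\ell+1,m-\ell-1}$ to $\mathcal P_{n+\ell+1,m-\ell-1}$. The map $\gamma$. For a path $P$, let $\min(P)$ be the minimum $y$-coordinate of its vertices.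 If $\min(P)<0$, $\gamma(P)$ is obtained by turning the $D$ step that ends at the leftmost vertex of height $\min(P)$ into a $U$ step. *)

(* Defs.v *)
From mathcomp Require Import all_boot all_order all_algebra.
From mathcomp Require Import zify.
From mathcomp Require Export classical_sets functions.

Set Implicit Arguments.
Unset Strict Implicit.
Unset Printing Implicit Defensive.

Import Order.TTheory GRing.Theory Num.Theory.
Local Open Scope classical_set_scope.

(* Parts are listed in weakly decreasing order, without trailing zeros. *)
Definition is_partition (lam : seq nat) : bool :=
  sorted geq lam && all (leq 1) lam.

(* The i-th part, counted from i = 1; it is 0 for i > size lam.  Only used
   with i >= 1. *)
Definition part (lam : seq nat) (i : nat) : nat := nth 0 lam i.-1.

Definition conjp (lam : seq nat) : seq nat :=
  [seq count (leq j) lam | j <- iota 1 (part lam 1)].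

Definition durfee (lam : seq nat) : nat :=
  \max_(1 <= i < (size lam).+1 | i <= part lam i) i.

(* Meaningful for 1 <= i <= durfee lam. *)
Definition rank (lam : seq nat) (i : nat) : int :=
  ((part lam i)%:Z - (part (conjp lam) i)%:Z)%R.

(* The box dimensions are integers: the set is empty if one is negative. *)
Definition Pbox (a b : int) : set (seq nat) :=
  [set lam | [/\ is_partition lam, (0 <= a)%R, (0 <= b)%R,
                 ((size lam)%:Z <= a)%R & ((part lam 1)%:Z <= b)%R]].

Definition weight (N : int) : set (seq nat) :=
  [set lam | (sumn lam)%:Z%R = N].

(* Complement of the set of partitions all of whose ranks are >= c. *)
Definition Rge_bar (c : int) : set (seq nat) :=
  [set lam | is_partition lam /\
     exists i, [/\ 1 <= i, i <= durfee lam & (rank lam i < c)%R]].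

(* Complement of the set of partitions all of whose ranks are <= c. *)
Definition Rle_bar (c : int) : set (seq nat) :=
  [set lam | is_partition lam /\
     exists i, [/\ 1 <= i, i <= durfee lam & (c < rank lam i)%R]].

Definition insert_part (j : nat) (lam : seq nat) : seq nat :=
  if j == 0 then lam else sort geq (j :: lam).

Definition min_rank_index (lam : seq nat) : nat :=
  \max_(1 <= i < (durfee lam).+1 |
        all (fun j => (rank lam i <= rank lam j)%R) (iota 1 (durfee lam))) i.

(* The part i.-1 is inserted as a column: one conjugates back afterwards.
   Outside its domain (no rank <= 0), fmap is the identity. *)
Definition fmap (lam : seq nat) : seq nat :=
  if has (fun i => (rank lam i <= 0)%R) (iota 1 (durfee lam)) then
    let i := min_rank_index lam in
    conjp (insert_part i.-1 (conjp (rem i lam)))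
  else lam.

(* The letter 1 (vertical step, or U) is true and the letter 2 (horizontal
   step, or D) is false. *)
Definition word := seq bool.
Notation up := true (only parsing).
Notation down := false (only parsing).

Definition G (a b : int) : set word :=
  [set w | (count_mem up w)%:Z%R = a /\ (count_mem down w)%:Z%R = b].

Definition height (w : word) (k : nat) : int :=
  ((count_mem up (take k w))%:Z - (count_mem down (take k w))%:Z)%R.

Definition heights (w : word) : seq int :=
  [seq height w k | k <- iota 0 (size w).+1].

(* The origin is a vertex, hence the default value 0 is attained. *)
Definition minh (w : word) : int :=
  \big[Order.min/0%R]_(y <- heights w) y.

Definition valley (w : word) (k : nat) : bool :=
  (nth up w k.-1 == down) && (nth down w k == up).

Definition maj (w : word) : nat :=
  \sum_(1 <= k < size w | valley w k) k.

Definition major (N : int) : set word := [set w | (maj w)%:Z%R = N].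

Definition A_bar (c : int) : set word :=
  [set w | exists2 k, k <= size w & (height w k < c)%R].

(* The k-th vertex ends the step of index k.-1.  Outside its domain
   (minh w < 0), gamma is the identity. *)
Definition gamma (w : word) : word :=
  if (minh w < 0)%R then
    let k := index (minh w) (heights w) in set_nth up w k.-1 up
  else w.

Definition word_of_part (a b : nat) (lam : seq nat) : word :=
  nseq (a - size lam) up
  ++ flatten [seq rcons (nseq (part lam i - part lam i.+1) down) up
             | i <- rev (iota 1 (size lam))]
  ++ nseq (b - part lam 1) down.

(* The vertical step at position j closes a row whose length is the number of
   horizontal steps before it. *)
Definition part_of_word (w : word) : seq nat :=
  [seq c <- rev [seq count_mem down (take j w)
                | j <- iota 0 (size w) & nth down w j == up] | 0 < c].

(* Foata's bijection, by recursion on the reversed word, whose head is the last letter. *)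
Fixpoint foata_rev (r : word) : word :=
  match r with
  | [::] => [::]
  | false :: r1 => rcons (foata_rev r1) down
  | true :: r1 =>
    match r1 with
    | [::] => [:: up]
    | true :: _ => up :: foata_rev r1
    | false :: r2 => down :: rcons (foata_rev r2) up
    end
  end.

Definition foata (w : word) : word := foata_rev (rev w).

Lemma foata0 : foata [::] = [::]. Proof. by []. Qed.

Lemma foata1 : foata [:: up] = [:: up]. Proof. by []. Qed.

Lemma foata_rcons2 w : foata (rcons w down) = rcons (foata w) down.
Proof. by rewrite /foata rev_rcons. Qed.

Lemma foata_rcons11 w :
  foata (rcons (rcons w up) up) = up :: foata (rcons w up).
Proof. by rewrite /foata !rev_rcons. Qed.

Lemma foata_rcons21 w :
  foata (rcons (rcons w down) up) = down :: rcons (foata w) up.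
Proof. by rewrite /foata !rev_rcons. Qed.

(* The inverse, by recursion on the length n of the word. *)
Fixpoint foata_inv_rec (n : nat) (v : word) : word :=
  if n is n1.+1 then
    match v with
    | [::] => [::]
    | x :: v1 =>
      if ~~ last x v1 then rcons (foata_inv_rec n1 (belast x v1)) down
      else if v1 is y :: v2 then
        if x then rcons (foata_inv_rec n1 v1) up
        else rcons (rcons (foata_inv_rec n1 (belast y v2)) down) up
      else [:: up]
    end
  else [::].

Definition foata_inv (v : word) : word := foata_inv_rec (size v) v.

Definition phi (w : word) : seq nat := part_of_word (foata w).

(* The inverse of phi on partitions contained in the a x b box; see phi_invK
   and phiK below. *)
Definition phi_inv (a b : nat) (lam : seq nat) : word :=
  foata_inv (word_of_part a b lam).

Lemma foata_ind (P : word -> Prop) :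
    P [::] -> P [:: up] ->
    (forall w, P w -> P (rcons w down)) ->
    (forall w, P (rcons w up) -> P (rcons (rcons w up) up)) ->
    (forall w, P w -> P (rcons (rcons w down) up)) ->
  forall w, P w.
Proof.
move=> P0 P1 P2 P11 P21 w; have [n] := ubnP (size w).
elim: n w => // n IHn w; case/lastP: w => // w [|]; rewrite size_rcons ltnS.
  case/lastP: w => // w [|] wn; first exact/P11/IHn.
  by apply/P21/IHn; move: wn; rewrite size_rcons => /ltnW.
by move=> wn; apply/P2/IHn.
Qed.

Lemma last_foata b w : last b (foata w) = last b w.
Proof.
elim/foata_ind: w b => // w IHw b; first by rewrite foata_rcons2 !last_rcons.
  by rewrite foata_rcons11 /= IHw !last_rcons.
by rewrite foata_rcons21 /= !last_rcons.
Qed.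

Lemma perm_foata w : perm_eq (foata w) w.
Proof.
apply/permP => p; elim/foata_ind: w => // w IHw.
- by rewrite foata_rcons2 -!cats1 !count_cat IHw.
- by rewrite foata_rcons11 /= IHw -!cats1 !count_cat /= addn0 addnC.
by rewrite foata_rcons21 /= -!cats1 !count_cat /= IHw !addn0 addnA
  (addnC (p false : nat)).
Qed.

Lemma foata_inv_recK n v : size v <= n -> foata (foata_inv_rec n v) = v.
Proof.
elim: n v => [|n IHn] [|x v] //=; rewrite ltnS => vn.
case: ifPn => [lf|/negPn lt].
  by rewrite foata_rcons2 IHn ?size_belast // lastI (negPf lf).
case: v vn lt => [|y v] /= vn lt; first by rewrite lt.
case: x.
  have vE := IHn (y :: v) vn.
  case/lastP: (foata_inv_rec n (y :: v)) vE => // u b vE.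
  have: b = up by have := last_foata down (rcons u b); rewrite vE /= lt last_rcons.
  by move=> bE; rewrite bE in vE *; rewrite foata_rcons11 vE.
by rewrite foata_rcons21 IHn ?size_belast 1?ltnW // (lastI y v) lt.
Qed.

Lemma foata_recK n w : size w <= n -> foata_inv_rec n (foata w) = w.
Proof.
elim: n w => [|n IHn] w; first by case: w.
have fs u : size (foata u) = size u by exact/perm_size/perm_foata.
case/lastP: w => // w [|]; rewrite size_rcons ltnS => wn.
  case/lastP: w wn => // w [|] wn.
    rewrite foata_rcons11.
    case E: (foata _) => [|y v].
      by move/(congr1 size): E; rewrite fs size_rcons.
    have lt : last y v = up.
      by have := last_foata down (rcons w up); rewrite E last_rcons.
    by rewrite /= lt -E IHn.
  rewrite foata_rcons21.
  case E: (rcons _ _) => [|y v]; first by move/(congr1 size): E; rewrite size_rcons.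
  have lt : last y v = up by rewrite -(last_rcons down (foata w) up) E.
  rewrite /= lt /=; move: E; rewrite (lastI y v) => /rcons_inj[<- _].
  by rewrite IHn // ltnW // -(size_rcons w down).
rewrite foata_rcons2.
case E: (rcons _ _) => [|y v]; first by move/(congr1 size): E; rewrite size_rcons.
have lt : last y v = down by rewrite -(last_rcons up (foata w) down) E.
rewrite /= lt /=; move: E; rewrite (lastI y v) => /rcons_inj[<- _].
by rewrite IHn.
Qed.

Lemma foata_invK : cancel foata_inv foata.
Proof. by move=> v; apply: foata_inv_recK. Qed.

Lemma foataK : cancel foata foata_inv.
Proof.
move=> w; apply: foata_recK; by rewrite (perm_size (perm_foata w)).
Qed.

Lemma word_of_part_cons a b x lam :
  word_of_part a b (x :: lam) =
  word_of_part a.-1 x lam ++ up :: nseq (b - x) down.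
Proof.
rewrite /word_of_part /= rev_cons map_rcons flatten_rcons.
have -> : a - (size lam).+1 = a.-1 - size lam by lia.
rewrite -!catA -cat_rcons.
congr (_ ++ (flatten _ ++ _)).
rewrite -[2]/(1 + 1) iotaDl -map_rev -map_comp.
apply/eq_in_map => i; rewrite mem_rev mem_iota => /andP[i0 _].
by case: i i0.
Qed.

Lemma part_of_word_rcons w x :
  part_of_word (rcons w x) =
  if x && (0 < count_mem down w) then count_mem down w :: part_of_word w
  else part_of_word w.
Proof.
rewrite /part_of_word size_rcons -[(size w).+1]addn1 iotaD add0n filter_cat.
rewrite map_cat rev_cat filter_cat /=.
rewrite nth_rcons ltnn eqxx eqb_id.
have -> : [seq count_mem down (take j (rcons w x))
          | j <- iota 0 (size w) & nth down (rcons w x) j == up] =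
        [seq count_mem down (take j w)
          | j <- iota 0 (size w) & nth down w j == up].
  have -> : [seq j <- iota 0 (size w) | nth down (rcons w x) j == up] =
            [seq j <- iota 0 (size w) | nth down w j == up].
    by apply/eq_in_filter => j; rewrite mem_iota add0n nth_rcons => /= ->.
  apply/eq_in_map => j; rewrite mem_filter mem_iota add0n => /and3P[_ _ jw].
  by rewrite -cats1 takel_cat // ltnW.
by case: x => //=; rewrite -cats1 take_size_cat //; case: ifP.
Qed.

Lemma is_partition_cons x lam :
  is_partition (x :: lam) = [&& 0 < x, part lam 1 <= x & is_partition lam].
Proof.
rewrite /is_partition /part; case: lam => [|y lam] /=; first by rewrite !andbT.
by case: (0 < x); case: (y <= x); rewrite /= ?andbF ?andbT.
Qed.

Lemma part_of_word_Pbox w : let lam := part_of_word w in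
  [/\ is_partition lam, size lam <= count_mem up w &
      part lam 1 <= count_mem down w].
Proof.
elim/last_ind: w => //= w x [lamP slam lam1].
rewrite part_of_word_rcons -cats1 !count_cat /=; case: x => /=.
  case: ifPn => [w0|_].
    by rewrite is_partition_cons w0 lam1 lamP /part /=; split=> //; lia.
  by split=> //; lia.
by split=> //; lia.
Qed.

Lemma part_of_wordK w :
  word_of_part (count_mem up w) (count_mem down w) (part_of_word w) = w.
Proof.
elim/last_ind: w => //= w x IHw.
have [lamP slam lam1] := part_of_word_Pbox w.
rewrite part_of_word_rcons -cats1 !count_cat /=; case: x => /=.
  rewrite !addn0 addn1; case: ifPn => [w0|].
    by rewrite word_of_part_cons IHw subnn.
  rewrite lt0n negbK => /eqP w0.
  have lam0 : part_of_word w = [::].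
    case: (part_of_word w) lamP lam1 => // y lam.
    by rewrite is_partition_cons w0 /part /=; lia.
  have wE : w = nseq (count_mem up w) up.
    by move: IHw; rewrite lam0 w0 /word_of_part /= cats0 subn0.
  rewrite lam0 w0 [in X in _ = X]wE /word_of_part /= !cats0.
  by rewrite -[[:: up]]/(nseq 1 up) -nseqD addn1.
rewrite !addn0 addn1 -[in RHS]IHw /word_of_part subSn // -(addn1 (_ - _)) nseqD.
by rewrite !catA.
Qed.

Lemma word_of_partK a b lam :
    is_partition lam -> size lam <= a -> part lam 1 <= b ->
  part_of_word (word_of_part a b lam) = lam.
Proof.
have nsD w m : part_of_word (w ++ nseq m down) = part_of_word w.
  by elim: m => [|m IHm]; rewrite ?cats0 // -addn1 nseqD catA cats1
    part_of_word_rcons.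
have cD a1 b1 l1 : is_partition l1 -> part l1 1 <= b1 ->
    count_mem down (word_of_part a1 b1 l1) = b1.
  elim: l1 a1 b1 => [|x l1 IHl] a1 b1.
    by rewrite /word_of_part /= count_cat !count_nseq /= /part /=; lia.
  rewrite is_partition_cons => /and3P[x0 xl l1P] xb.
  rewrite word_of_part_cons count_cat IHl //= count_nseq.
  by move: xb; rewrite /part /=; lia.
elim: lam a b => [|x lam IHlam] a b.
  move=> _ _ _; rewrite /word_of_part /= nsD.
  elim: (a - 0) => // n IHn; rewrite -addn1 nseqD cats1 part_of_word_rcons.
  by rewrite count_nseq IHn.
rewrite is_partition_cons => /and3P[x0 xl lamP] sl xb.
rewrite word_of_part_cons -cat_rcons nsD part_of_word_rcons /= cD // x0.
by rewrite IHlam //; move: sl => /=; lia.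
Qed.

Lemma word_of_part_G a b lam :
  Pbox a%:Z%R b%:Z%R lam -> G a%:Z%R b%:Z%R (word_of_part a b lam).
Proof.
case=> lamP _ _; rewrite !lez_nat => slam lam1.
suff [cU cD] : count_mem up (word_of_part a b lam) = a /\
               count_mem down (word_of_part a b lam) = b.
  by rewrite /G /= cU cD.
elim: lam a b lamP slam lam1 => [|x lam IHlam] a b.
  by rewrite /word_of_part /= !count_cat !count_nseq /= /part /=; lia.
rewrite is_partition_cons => /and3P[x0 xl lamP] sl xb.
rewrite word_of_part_cons (count_cat _ (word_of_part _ _ _)) /=.
rewrite (count_cat _ (word_of_part _ _ _)) /= !count_nseq.
have [cU cD] : count_mem up (word_of_part a.-1 x lam) = a.-1 /\
               count_mem down (word_of_part a.-1 x lam) = x.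
  by apply: IHlam => //; move: sl => /=; lia.
by rewrite cU cD /=; move: sl xb; rewrite /part /=; lia.
Qed.

Lemma phi_invK a b lam : Pbox a%:Z%R b%:Z%R lam -> phi (phi_inv a b lam) = lam.
Proof.
case=> lamP _ _; rewrite !lez_nat => slam lam1.
by rewrite /phi /phi_inv foata_invK word_of_partK.
Qed.

Lemma phiK a b w : G a%:Z%R b%:Z%R w -> phi_inv a b (phi w) = w.
Proof.
case=> -[<-] [<-]; rewrite /phi /phi_inv.
have /permP cE := perm_foata w.
by rewrite -!cE part_of_wordK foataK.
Qed.

Lemma phi_Pbox a b w : G a%:Z%R b%:Z%R w -> Pbox a%:Z%R b%:Z%R (phi w).
Proof.
case=> -[<-] [<-]; have [lamP slam lam1] := part_of_word_Pbox (foata w).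
have /permP cE := perm_foata w.
by split; rewrite // lez_nat -cE.
Qed.

Lemma phi_inv_G a b lam :
  Pbox a%:Z%R b%:Z%R lam -> G a%:Z%R b%:Z%R (phi_inv a b lam).
Proof.
move=> /word_of_part_G[cU cD]; rewrite /G /= -cU -cD.
have := perm_foata (phi_inv a b lam); rewrite {1}/phi_inv foata_invK.
by move=> /permP cE; rewrite -!cE.
Qed.

(* Main.v *)
Require Import Defs.
From mathcomp Require Import all_boot all_order all_algebra.
From mathcomp Require Import classical_sets functions.
From mathcomp Require Import zify.

(* Read a word from right to left: each factor 21 (a valley of the path) makes
   Foata's bijection put a 2 at the left end and a 1 at the right end, that is,
   it adds a hook around the diagram.  Hence the Durfee size of phi w is the
   number of valleys of w, the i-th rank of phi w is -1 - h, where h is the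
   height of the i-th valley from the right, and |phi w| = maj w.

   So the minimal rank of the largest index in the conjugate of phi w
   corresponds to the leftmost vertex of minimal height.  There w = A 2 1 B and
   gamma w = A 1 1 B; the letters coming from B are placed in the same way in
   both cases, as L on the left and R on the right, and
   phi (A 2 1 B) = L M 2 1 R, phi (A 1 1 B) = L 1 M 1 R for some M.
   Deleting this 2 and inserting this 1 are the two steps of f. *)

Set Implicit Arguments.
Unset Strict Implicit.
Unset Printing Implicit Defensive.

Import Order.TTheory GRing.Theory Num.Theory.

(** * Partitions and boundary words *)

Lemma partS x lam i : part (x :: lam) i.+2 = part lam i.+1.
Proof. by []. Qed.

Lemma eq_part l1 l2 :
    is_partition l1 -> is_partition l2 ->
    (forall i, 0 < i -> part l1 i = part l2 i) ->
  l1 = l2.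
Proof.
elim: l1 l2 => [|x l1 IHl] [|y l2] //.
- by move=> _ /[!is_partition_cons]/andP[y0 _] /(_ 1 isT); rewrite /part /=; lia.
- by move=> /[!is_partition_cons]/andP[x0 _] _ /(_ 1 isT); rewrite /part /=; lia.
rewrite !is_partition_cons => /and3P[_ _ l1P] /and3P[_ _ l2P] E.
congr (_ :: _); first exact: (E 1).
by apply: IHl => // -[//|i] _; apply: (E i.+2).
Qed.

Lemma leq_part1 lam x : is_partition lam -> x \in lam -> x <= part lam 1.
Proof.
elim: lam => // y lam IHl /[!is_partition_cons]/and3P[_ yl lamP].
rewrite inE => /predU1P[->//|/IHl xl].
exact: leq_trans (xl lamP) yl.
Qed.

Lemma conjp_is_partition lam : is_partition lam -> is_partition (conjp lam).
Proof.
move=> lamP; apply/andP; split.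
  have: sorted ltn (iota 1 (part lam 1)) by apply: iota_ltn_sorted.
  rewrite /conjp sorted_map; apply: sub_sorted => i j /= ij.
  by apply: sub_count => k /= jk; apply: leq_trans (ltnW ij) jk.
apply/allP => _ /mapP[j + ->]; rewrite mem_iota => /andP[j0 jl].
rewrite -has_count; case: lam {lamP} jl => [|x lam]; rewrite /part /=; first lia.
by rewrite add1n ltnS => ->.
Qed.

Lemma part_conjp lam j :
  is_partition lam -> 0 < j -> part (conjp lam) j = count (leq j) lam.
Proof.
move=> lamP j0; rewrite {1}/part /conjp.
have [jl|lj] := leqP j (part lam 1).
  by rewrite (nth_map 0) ?size_iota ?nth_iota ?add1n ?prednK //; lia.
rewrite nth_default; last by rewrite size_map size_iota; lia.
apply/esym/eqP; rewrite -leqn0 leqNgt -has_count; apply/hasPn => x /leq_part1.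
by move=> /(_ lamP); lia.
Qed.

Lemma part_of_word_is_partition w : is_partition (part_of_word w).
Proof. by have [] := part_of_word_Pbox w. Qed.
#[local] Hint Resolve part_of_word_is_partition : core.

Lemma part_of_word_surj lam :
  is_partition lam -> exists w, lam = part_of_word w.
Proof.
by move=> lamP; exists (word_of_part (size lam) (part lam 1) lam);
  rewrite word_of_partK.
Qed.

Lemma part_of_word_nodown w :
  count_mem false w = 0 -> part_of_word w = [::].
Proof.
move=> w0; have [lamP _] := part_of_word_Pbox w.
case: (part_of_word w) lamP => // y lam.
by rewrite is_partition_cons w0 /part /=; lia.
Qed.

Lemma part_of_word_up w : part_of_word (true :: w) = part_of_word w.
Proof.
by elim/last_ind: w => // w x IHw; rewrite -rcons_cons !part_of_word_rcons IHw.
Qed.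

(** An empty row is not recorded as a part, but then the whole diagram is empty and every [part] is
    the default 0, so no case distinction remains. *)
Lemma part_part_of_word_rcons_up w i :
  part (part_of_word (rcons w true)) i.+1 =
  if i is j.+1 then part (part_of_word w) i else count_mem false w.
Proof.
rewrite part_of_word_rcons /=; case: ifPn => [_|]; first by case: i.
rewrite lt0n negbK => /eqP w0; rewrite (part_of_word_nodown w0) w0.
by case: i => // i; rewrite /part !nth_nil.
Qed.

(** A leading 2 is a new first column. It meets every vertical step of [w], so even rows of length 0
    grow to length 1. *)
Lemma part_part_of_word_down w i :
  0 < i ->
  part (part_of_word (false :: w)) i =
  (i <= count_mem true w) + part (part_of_word w) i.
Proof.
elim/last_ind: w i => [|w x IHw] [//|i] _.
  by rewrite /part /= !nth_nil.
case: x; last first.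
  rewrite -rcons_cons !part_of_word_rcons /= IHw //.
  by rewrite -cats1 count_cat addn0.
rewrite -rcons_cons !part_part_of_word_rcons_up -cats1 count_cat /=.
case: i => [|i]; first by rewrite !addn1.
by rewrite IHw // !addn1.
Qed.

(** Conjugation reflects the boundary in the diagonal: the word is read backwards with its letters
    exchanged. A last letter 1, which adds a row, becomes a leading 2, which adds a column. *)
Lemma conjp_part_of_word w :
  conjp (part_of_word w) = part_of_word (rev (map negb w)).
Proof.
apply: eq_part => // [|j j0]; first exact: conjp_is_partition.
rewrite part_conjp //; elim/last_ind: w => [|w x IHw].
  by rewrite /part nth_nil.
rewrite map_rcons rev_rcons part_of_word_rcons; case: x => /=.
  rewrite part_part_of_word_down // -IHw count_rev count_map.
  rewrite (@eq_count _ (preim _ _) (pred1 false)); last by case.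
  case: ifPn => // w0.
  by move: w0; rewrite lt0n negbK => /eqP->; rewrite leqNgt j0.
by rewrite IHw part_of_word_up.
Qed.

Lemma conjpK lam : is_partition lam -> conjp (conjp lam) = lam.
Proof.
move=> /part_of_word_surj[w ->]; rewrite !conjp_part_of_word map_rev revK.
by rewrite -map_comp map_id_in // => -[].
Qed.

Lemma size_conjp lam : size (conjp lam) = part lam 1.
Proof. by rewrite size_map size_iota. Qed.

Lemma part_conjp1 lam : is_partition lam -> part (conjp lam) 1 = size lam.
Proof.
by move=> lamP; rewrite -size_conjp conjpK.
Qed.

Lemma sumn_part_of_word_rcons_up w :
  sumn (part_of_word (rcons w true)) = count_mem false w + sumn (part_of_word w).
Proof.
by rewrite part_of_word_rcons /=; case: ifPn => //; rewrite lt0n negbK => /eqP->.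
Qed.

Lemma sumn_part_of_word_down w :
  sumn (part_of_word (false :: w)) = count_mem true w + sumn (part_of_word w).
Proof.
elim/last_ind: w => // w [] IHw; rewrite -rcons_cons.
  by rewrite !sumn_part_of_word_rcons_up IHw -cats1 count_cat /=; lia.
by rewrite !part_of_word_rcons /= IHw -cats1 count_cat /=; lia.
Qed.

Lemma sumn_conjp lam : is_partition lam -> sumn (conjp lam) = sumn lam.
Proof.
move=> /part_of_word_surj[w ->]; rewrite conjp_part_of_word.
elim/last_ind: w => // w x IHw; rewrite map_rcons rev_rcons; case: x => /=.
  rewrite sumn_part_of_word_rcons_up sumn_part_of_word_down IHw.
  rewrite count_rev count_map.
  by rewrite (@eq_count _ (preim _ _) (pred1 false)) //; case.
by rewrite part_of_word_up IHw part_of_word_rcons.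
Qed.

(** A vertical step after [A] adds a row as long as the number of horizontal steps in [A] and keeps
    the other rows. A permutation suffices, since partitions are sorted. *)
Lemma perm_part_of_word_insert A B :
  perm_eq (part_of_word (A ++ true :: B))
    (if 0 < count_mem false A then count_mem false A :: part_of_word (A ++ B)
     else part_of_word (A ++ B)).
Proof.
elim/last_ind: B => [|B x IHB].
  by rewrite cats1 cats0 part_of_word_rcons.
rewrite -rcons_cons -!rcons_cat !part_of_word_rcons !count_cat /= add0n.
move: IHB; case: ifP => // _ IHB; case: ifP => // _.
  move: IHB; rewrite -(perm_cons (count_mem false A + count_mem false B)).
  move=> /perm_trans; apply.
  exact/permPl/(perm_catCA [:: _] [:: _]).
by rewrite perm_cons.
Qed.

Lemma sorted_geq_perm (s t : seq nat) :
  sorted geq s -> sorted geq t -> perm_eq s t -> s = t.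
Proof.
by apply: sorted_eq => [y x z /= xy yz|x y /=]; [exact: leq_trans yz xy|lia].
Qed.

Lemma insert_part_of_word A B :
  insert_part (count_mem false A) (part_of_word (A ++ B)) =
  part_of_word (A ++ true :: B).
Proof.
have := perm_part_of_word_insert A B; rewrite /insert_part lt0n.
have sP w : sorted geq (part_of_word w).
  by case/andP: (part_of_word_is_partition w).
case: eqP => /= _ E; first by apply: sorted_geq_perm => //; rewrite perm_sym.
apply: sorted_geq_perm => //; first by apply: sort_sorted => x y /=; lia.
by rewrite perm_sort perm_sym.
Qed.

Lemma rem_part_of_word A B :
  0 < count_mem false A ->
  rem (count_mem false A) (part_of_word (A ++ true :: B)) = part_of_word (A ++ B).
Proof.
move=> A0; have := perm_part_of_word_insert A B; rewrite A0 => E.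
have sP w : sorted geq (part_of_word w).
  by case/andP: (part_of_word_is_partition w).
have geqT : transitive geq by move=> y x z /= xy yz; exact: leq_trans yz xy.
apply: sorted_geq_perm => //.
  by apply: subseq_sorted (rem_subseq _ _) (sP _).
have cE: count_mem false A \in part_of_word (A ++ true :: B).
  by rewrite (perm_mem E) mem_head.
by rewrite -(perm_cons (count_mem false A)) -(permPl (perm_to_rem cE)).
Qed.

(** * Valleys and successive ranks *)

(** Listed from right to left, so that the [i]-th entry goes with the [i]-th hook: the last factor
    21 of the word gives the outermost one. *)
Definition valleys (w : word) : seq nat :=
  rev [seq k <- index_iota 1 (size w) | valley w k].

Lemma valleys_rcons w x :
  valleys (rcons w x) =
  if x && ~~ last true w then size w :: valleys w else valleys w.
Proof.
rewrite /valleys size_rcons; case/lastP: w => [|w y]; first by case: x.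
rewrite last_rcons size_rcons /index_iota !subSS !subn0.
rewrite -(addn1 (size w)) iotaD filter_cat rev_cat add1n /=.
rewrite (@eq_in_filter _ _ (valley (rcons w y))) => [|k].
  rewrite /valley -(size_rcons w y) (nth_rcons _ _ _ (size _)) ltnn eqxx.
  rewrite size_rcons !nth_rcons size_rcons ltnSn ltnn eqxx.
  by rewrite -addn1; move: (size w) => s; case: x; case: y; rewrite /= ?addn1.
rewrite mem_iota => kw; rewrite /valley !(nth_rcons _ (rcons _ _)) size_rcons.
by rewrite !ifT //; lia.
Qed.

Lemma mem_valleys w k : k \in valleys w -> 0 < k < size w.
Proof. by rewrite mem_rev mem_filter mem_index_iota => /andP[]. Qed.

Lemma maj_valleys w : maj w = sumn (valleys w).
Proof. by rewrite sumn_rev sumnE big_filter. Qed.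

(** A final 21 adds a hook of size [(size w).+1], which is the x-coordinate of the new valley. A 1
    put at the left end or a 2 at the right end leaves the diagram unchanged. *)
Lemma sumn_phi w : sumn (phi w) = maj w.
Proof.
rewrite maj_valleys /phi; elim/foata_ind: w => // w IHw.
- by rewrite foata_rcons2 part_of_word_rcons valleys_rcons.
- by rewrite foata_rcons11 part_of_word_up IHw (valleys_rcons (rcons _ _))
    last_rcons.
have /permP cE := perm_foata w.
rewrite foata_rcons21 -rcons_cons sumn_part_of_word_rcons_up.
rewrite sumn_part_of_word_down IHw (valleys_rcons (rcons _ _)) last_rcons /=.
rewrite valleys_rcons size_rcons !cE -(count_predC (pred1 true) w).
by rewrite (@eq_count _ (predC _) (pred1 false)) => [|[]//] /=; lia.
Qed.

Lemma height_cat w1 w2 k : k <= size w1 -> height (w1 ++ w2) k = height w1 k.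
Proof. by move=> kw; rewrite /height takel_cat. Qed.

Lemma height_rcons w x k : k <= size w -> height (rcons w x) k = height w k.
Proof. by move=> kw; rewrite -cats1 height_cat. Qed.

Lemma height_size w :
  height w (size w) = ((count_mem true w)%:Z - (count_mem false w)%:Z)%R.
Proof. by rewrite /height take_size. Qed.

Lemma nth_valleys w i : 0 < i <= size (valleys w) ->
  0 < nth 0 (valleys w) i.-1 < size w.
Proof. by case/andP=> i0 iw; apply/mem_valleys/mem_nth; rewrite prednK. Qed.

Lemma conjp_foata21 w : conjp (part_of_word (false :: rcons w true)) =
  part_of_word (false :: rcons (rev (map negb w)) true).
Proof. by rewrite conjp_part_of_word /= map_rcons rev_cons rev_rcons. Qed.

Lemma count_false_conj w :
  count_mem false (rev (map negb w)) = count_mem true w.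
Proof. by rewrite count_rev count_map; apply: eq_count; case. Qed.

Lemma count_true_conj w :
  count_mem true (rev (map negb w)) = count_mem false w.
Proof. by rewrite count_rev count_map; apply: eq_count; case. Qed.

(** Induction along Foata's recursion. A new hook shifts the old ranks by one index without changing
    them; the new first rank is minus the final height of [w], and the new valley lies one below
    that height. The Durfee condition is proved alongside because it bounds the index in the rank
    formula. *)
Lemma rank_phi w i : 0 < i ->
  ((i <= part (phi w) i) = (i <= size (valleys w))) /\
  (i <= size (valleys w) ->
   rank (phi w) i = (- 1 - height w (nth 0%N (valleys w) i.-1))%R).
Proof.
rewrite /phi; elim/foata_ind: w i => [||w IHw|w IHw|w IHw] i i0.
- by rewrite /part nth_nil; split=> /=; lia.
- by rewrite /part nth_nil; split=> /=; lia.
- rewrite foata_rcons2 part_of_word_rcons valleys_rcons /=.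
  have [<- E] := IHw i i0; split=> // iw; rewrite E // height_rcons //.
  by have [E1 _] := IHw i i0; have := @nth_valleys w i; rewrite -E1; lia.
- rewrite foata_rcons11 part_of_word_up (valleys_rcons (rcons _ _)) last_rcons /=.
  have [<- E] := IHw i i0; split=> // iw.
  rewrite E // (@height_rcons (rcons _ _)) //.
  have [E1 _] := IHw i i0; have := @nth_valleys (rcons w true) i.
  by rewrite -E1; lia.
have /permP cE := perm_foata w.
rewrite foata_rcons21 (valleys_rcons (rcons _ _)) last_rcons /= valleys_rcons /=.
rewrite size_rcons /rank conjp_foata21 -!rcons_cons.
case: i i0 => // -[|i] _; rewrite !part_part_of_word_rcons_up /=.
  split=> // _; rewrite count_false_conj !cE.
  rewrite height_rcons ?size_rcons // -(size_rcons w false) height_size.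
  by rewrite -cats1 !count_cat /=; lia.
rewrite !part_part_of_word_down //= count_true_conj !cE.
have [E1 E2] := IHw i.+1 isT.
have [_ _ p1] := part_of_word_Pbox (foata w).
(* Inside the old Durfee square, the new column meets row [i.+1] and the new row meets column
   [i.+1], so the two increments cancel in the rank. *)
have cnt v j : 0 < part (part_of_word v) j.+1 -> j < count_mem true v.
  have [_ sv _] := part_of_word_Pbox v; rewrite /part /= => pj.
  apply: leq_trans sv; rewrite ltnNge; apply/negP => sj.
  by rewrite nth_default in pj.
have c1 := cnt (foata w) i; rewrite cE in c1.
have rk : i < part (part_of_word (foata w)) i.+1 -> i < count_mem false w.
  move=> iw; rewrite -cE; apply: leq_trans iw _; apply: leq_trans p1.
  have [iw|iw] := ltnP i (size (part_of_word (foata w))).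
    by apply: leq_part1 => //; apply: mem_nth.
  by rewrite /part /= nth_default.
split.
  rewrite ltnS -E1; case: (ltnP i (count_mem true w)) c1 => /= ci; last by lia.
  by rewrite add1n ltnS.
rewrite ltnS => iw; have /E2 := iw; rewrite /rank conjp_part_of_word.
have jw := @nth_valleys w i.+1.
have ip : i < part (part_of_word (foata w)) i.+1 by rewrite E1.
rewrite rk // c1 ?(leq_trans _ ip) //=.
rewrite (@height_rcons (rcons _ _)) ?size_rcons; last by move: (jw iw) => /=; lia.

rewrite height_rcons /=; last by move: (jw iw) => /=; lia.
lia.
Qed.

Lemma durfee_eq lam s :
  (forall i, 0 < i -> (i <= part lam i) = (i <= s)) -> durfee lam = s.
Proof.
move=> E; apply/eqP; rewrite eqn_leq; apply/andP; split.
  apply/bigmax_leqP_seq => i; rewrite mem_index_iota => /andP[i0 _].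
  by rewrite E.
case: s E => // s E; have := E s.+1 isT; rewrite leqnn => sl.
apply: leq_bigmax_seq; rewrite // mem_index_iota /= ltnS.
by move: sl; rewrite /part /=; have [//|ss] := ltnP s (size lam); rewrite nth_default.
Qed.

Lemma durfee_phi w : durfee (phi w) = size (valleys w).
Proof. by apply: durfee_eq => i /(rank_phi w)[]. Qed.

(** * The leftmost minimum of a path *)

Lemma phi_is_partition w : is_partition (phi w).
Proof. exact: part_of_word_is_partition. Qed.
#[local] Hint Resolve phi_is_partition : core.

(** Both sides say that the cell in row [k] and column [j] lies in the diagram. *)
Lemma leq_count_part lam j k : is_partition lam -> 0 < j -> 0 < k ->
  (k <= count (leq j) lam) = (j <= part lam k).
Proof.
move=> + j0; elim: lam k => [|x lam IHlam] k.
  by move=> _ k0; rewrite /part nth_nil /=; lia.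
rewrite is_partition_cons => /and3P[x0 xl lamP]; case: k => // -[|k] _ /=.
  have := IHlam 1 lamP isT; rewrite {2}/part /=.
  by case: (leqP j x) => jx; lia.
have := IHlam 1 lamP isT; have := IHlam k.+1 lamP isT; rewrite partS.
by case: (leqP j x) => jx; lia.
Qed.

Lemma rank_conjp lam i : is_partition lam -> rank (conjp lam) i = (- rank lam i)%R.
Proof. by move=> lamP; rewrite /rank conjpK // opprB. Qed.

Lemma durfee_conjp_phi w : durfee (conjp (phi w)) = size (valleys w).
Proof.
apply: durfee_eq => i i0; rewrite part_conjp ?leq_count_part //.
by have [] := rank_phi w i0.
Qed.

Lemma rank_conjp_phi w i : 0 < i <= size (valleys w) ->
  rank (conjp (phi w)) i = (1 + height w (nth 0%N (valleys w) i.-1))%R.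
Proof.
case/andP=> i0 iw; rewrite rank_conjp //; have [_ ->//] := rank_phi w i0; lia.
Qed.

(** As valleys run from right to left, the largest index of a minimal rank belongs to the leftmost
    lowest valley: those in [X], to the right of [p], may tie with it, those in [Y] may not. *)
Lemma min_rank_index_phi w X p Y :
    valleys w = X ++ p :: Y ->
    (forall k, k \in X -> (height w p <= height w k)%R) ->
    (forall k, k \in Y -> (height w p < height w k)%R) ->
  min_rank_index (conjp (phi w)) = (size X).+1.
Proof.
move=> E HX HY; rewrite /min_rank_index durfee_conjp_phi.
have sE : size (valleys w) = size X + (size Y).+1 by rewrite E size_cat.
have rp : rank (conjp (phi w)) (size X).+1 = (1 + height w p)%R.
  rewrite rank_conjp_phi; last by rewrite sE; lia.
  by rewrite E nth_cat ltnn subnn.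
have HY' (i : nat) : (size X).+1 < i -> i <= size (valleys w) ->
    (height w p < height w (nth 0%N (valleys w) i.-1))%R.
  move=> Xi iw; apply: HY; rewrite E nth_cat ifF; last by lia.
  have -> : i.-1 - size X = (i.-1 - size X).-1.+1 by lia.
  have Yi : (i.-1 - size X).-1 < size Y by lia.
  exact: mem_nth.
apply/eqP; rewrite eqn_leq; apply/andP; split.
  apply/bigmax_leqP_seq => /= i; rewrite mem_index_iota ltnS => iw /allP.
  move=> /(_ (size X).+1); rewrite mem_iota rp rank_conjp_phi // => /(_ _) H.
  have {}H : (height w (nth 0%N (valleys w) i.-1) <= height w p)%R by lia.
  rewrite leqNgt; apply/negP => Xi; move: H; rewrite leNgt (HY' _ Xi) //.
  by case/andP: iw.
apply: leq_bigmax_seq; first by rewrite mem_index_iota; lia.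
apply/allP => /= j; rewrite mem_iota => jw; rewrite rp rank_conjp_phi; last by lia.
rewrite lerD2l; have : nth 0%N (valleys w) j.-1 \in valleys w.
  have jV : j.-1 < size (valleys w) by lia.
  exact: mem_nth.
rewrite [X in _ \in X -> _]E mem_cat inE => /or3P[/HX//|/eqP->//|/HY/ltW//].
Qed.

Lemma foata_cat_up n t : exists L R X,
  [/\ size X = count_mem false L, size X = count_mem true R, all (ltn n) X &
    forall u, size u = n ->
      foata (u ++ true :: t) = L ++ foata (rcons u true) ++ R /\
      valleys (u ++ true :: t) = X ++ valleys (rcons u true)].
Proof.
elim/foata_ind: t => [||t|t|t].
- by exists [::], [::], [::]; split=> // u _; rewrite cats0 cats1.
- exists [:: true], [::], [::]; split=> // u _.
  rewrite cats0 -cat_rcons cats1 foata_rcons11; split=> //.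
  by rewrite valleys_rcons last_rcons.
- move=> [L [R [X [sL sR nX E]]]]; exists L, (rcons R false), X; split=> //.
    by rewrite -cats1 count_cat addn0.
  move=> u /E[E1 E2]; rewrite -rcons_cons -rcons_cat foata_rcons2 E1.
  by rewrite valleys_rcons E2 !rcons_cat.
- move=> [L [R [X [sL sR nX E]]]]; exists (true :: L), R, X; split=> //.
  move=> u /E[E1 E2]; rewrite -!rcons_cons -!rcons_cat in E1 E2 *.
  rewrite foata_rcons11 E1; split=> //.
  by rewrite valleys_rcons last_rcons andbF.
move=> [L [R [X [sL sR nX E]]]].
exists (false :: L), (rcons R true), ((n + size t).+2 :: X); split.
- by rewrite /= sL.
- by rewrite -cats1 count_cat -sR /= addn0 addn1.
- by rewrite /= nX andbT; lia.
move=> u un; have [E1 E2] := E u un; rewrite -!rcons_cons -!rcons_cat.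
rewrite foata_rcons21 E1; split; first by rewrite !rcons_cat.
rewrite (valleys_rcons (rcons _ _)) last_rcons valleys_rcons /= E2.
by rewrite size_rcons size_cat /= un addnS.
Qed.

(** If a D step joins [A] to [C], it ends at the leftmost minimum of the path; if a U step does, it
    starts at the rightmost one. Omitting the joining step lets one condition serve both [gamma] and
    its inverse. *)
Definition first_min (A C : word) :=
  (forall k, k <= size A -> (height A (size A) <= height A k)%R) /\
  (forall k, k <= size C -> (0 <= height C k)%R).

Lemma height0 w : height w 0 = 0%R.
Proof. by rewrite /height take0. Qed.

Lemma height_catr A C j :
  height (A ++ C) (size A + j) = (height A (size A) + height C j)%R.
Proof.
rewrite /height takeD take_size_cat // drop_size_cat // take_size !count_cat.
by lia.
Qed.

Lemma height_cons x C j :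
  height (x :: C) j.+1 = ((if x then 1 else -1) + height C j)%R.
Proof. by rewrite /height /=; case: x => /=; lia. Qed.

Lemma first_min_last A C :
  first_min A C -> A != [::] -> exists A', A = rcons A' false.
Proof.
case/lastP: A => // A x [H _] _; exists A; case: x H => // H.
have := H (size A); rewrite (height_rcons _ (leqnn _)) !height_size size_rcons.
by rewrite -cats1 !count_cat /= => /(_ (leqnSn _)); lia.
Qed.

Lemma first_min_ge A C k :
  first_min A C -> k <= size (A ++ false :: C) ->
  (height A (size A) - 1 <= height (A ++ false :: C) k)%R.
Proof.
move=> [HA HC]; rewrite size_cat /= => kw; case: (leqP k (size A)) => kA.
  by rewrite height_cat //; have := HA k kA; lia.
have -> : k = size A + (k - size A).-1.+1 by lia.
rewrite height_catr height_cons.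
by have := HC (k - size A).-1; lia.
Qed.

Lemma height_first_min A C :
  height (A ++ false :: C) (size A).+1 = (height A (size A) - 1)%R.
Proof. by rewrite -addn1 height_catr height_cons height0; lia. Qed.

Lemma first_min_ge_up A C k :
  first_min A C -> k <= size (A ++ true :: C) ->
  (height A (size A) <= height (A ++ true :: C) k)%R.
Proof.
move=> [HA HC]; rewrite size_cat /= => kw; case: (leqP k (size A)) => kA.
  by rewrite height_cat //; have := HA k kA; lia.
have -> : k = size A + (k - size A).-1.+1 by lia.
rewrite height_catr height_cons.
by have := HC (k - size A).-1; lia.
Qed.

Lemma first_min_le0 A C : first_min A C -> (height A (size A) <= 0)%R.
Proof. by case=> HA _; have := HA 0 isT; rewrite height0. Qed.

Lemma bigmin_eq (m : int) s :
  (m <= 0)%R -> m \in s -> (forall y, y \in s -> (m <= y)%R) ->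
  \big[Order.min/0%R]_(y <- s) y = m.
Proof.
move=> m0 ms H; apply/le_anti/andP; split.
  elim: s ms {H} => // y s IHs; rewrite inE big_cons ge_min => /predU1P[->|/IHs->].
    by rewrite lexx.
  by rewrite orbT.
rewrite big_seq; elim/big_rec: _ => // y x ys mx.
by rewrite le_min mx H.
Qed.

Lemma set_nth_cat_size T (x0 y z : T) s t :
  set_nth x0 (s ++ y :: t) (size s) z = s ++ z :: t.
Proof. by elim: s => //= x s ->. Qed.

Lemma mem_heightsP w y :
  reflect (exists2 k, k <= size w & y = height w k) (y \in heights w).
Proof.
apply: (iffP mapP) => -[k kw ->]; exists k => //.
  by move: kw; rewrite mem_iota.
by rewrite mem_iota.
Qed.

Lemma gamma_first_min A C :
  first_min A C -> gamma (A ++ false :: C) = A ++ true :: C.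
Proof.
move=> AC; rewrite /gamma; set w := A ++ _.
have mE : minh w = (height A (size A) - 1)%R.
  apply: bigmin_eq; first by have := first_min_le0 AC; lia.
    apply/mem_heightsP; exists (size A).+1; rewrite ?height_first_min //.
    by rewrite size_cat /=; lia.
  by move=> y /mem_heightsP[k kw ->]; apply: first_min_ge.
rewrite mE ifT; last by have := first_min_le0 AC; lia.
(* All vertices of [A] are strictly higher, so [index] finds the end of the D step, whose own
   position is [size A]. *)
have -> : index (height A (size A) - 1)%R (heights w) = (size A).+1.
  rewrite /heights size_cat -addSn iotaD map_cat index_cat.
  rewrite ifF.
    rewrite add0n /= size_map size_iota height_first_min eqxx addn0 //.
  apply/mapP => -[k]; rewrite mem_iota => kA.
  rewrite height_cat; last lia; move=> E; case: AC => /(_ k) + _; lia.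
exact: set_nth_cat_size.
Qed.

(** The path grows letter by letter: either it has stayed at or above 0, or the step to its leftmost
    minimum is known. The former is excluded by a vertex below [c <= 0]. *)
Lemma first_min_exists c w : (c <= 0)%R -> A_bar c w ->
  exists A C, [/\ w = A ++ false :: C, first_min A C
                & (height A (size A) - 1 < c)%R].
Proof.
move=> c0 [k0 k0w k0c].
suff [H|[A [C [wE AC]]]] : (forall k, k <= size w -> (0 <= height w k)%R) \/
    exists A C, w = A ++ false :: C /\ first_min A C.
- by have := H k0 k0w; lia.
- exists A, C; split=> //; apply: le_lt_trans k0c.
  by rewrite wE in k0w *; apply: first_min_ge.
elim/last_ind: w {k0 k0w k0c} => [|w x IHw].
  by left=> -[|//] _; rewrite height0.
case: IHw => [H|[A [C [wE AC]]]].
  have [h0|h0] := leP 0%R (height (rcons w x) (size w).+1).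
    left=> k; rewrite size_rcons leq_eqVlt => /predU1P[->//|kw].
    by rewrite height_rcons //; apply: H.
  right; exists w, [::]; rewrite cats1; split.
    congr (rcons _ _); case: x h0 => //; have := H (size w) (leqnn _).
    rewrite -(size_rcons w true) !height_size -cats1 !count_cat /=; lia.
  split=> [k /H|[|//] _]; last by rewrite height0.
  apply: le_trans; move: h0; rewrite -(size_rcons w x) !height_size.
  by rewrite -cats1 !count_cat /=; case: x => /=; lia.
right; have [h0|h0] := leP 0%R (height (rcons C x) (size C).+1).
  exists A, (rcons C x); rewrite wE rcons_cat; split=> //.
  case: AC => HA HC; split=> // k; rewrite size_rcons leq_eqVlt => /predU1P[->//|kw].
  by rewrite height_rcons //; apply: HC.
(* The new letter is a D step passing below the former minimum. *)
exists w, [::]; case: (AC) => HA HC; have hC := HC (size C) (leqnn _).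
rewrite -(size_rcons C x) !height_size -cats1 !count_cat /= in h0 hC.
split; first by rewrite cats1; case: x h0 => //=; lia.
split=> [k kw|[|//] _]; last by rewrite height0.
rewrite wE in kw *; apply: le_trans (first_min_ge AC kw).
rewrite !height_size !count_cat /=; case: x h0 => /=; lia.
Qed.

(** For the inverse of [gamma]: the U step to turn back leaves the last vertex of minimal height. It
    exists because the path has a vertex below [c + 1] but ends at height [c + 2] or more. *)
Lemma first_min_exists_up c w :
  A_bar (c + 1) w -> (c + 2 <= height w (size w))%R ->
  exists A C, [/\ w = A ++ true :: C, first_min A C
                & (height A (size A) - 1 < c)%R].
Proof.
move=> [k0 k0w k0c] wc.
suff [H|[A [C [wE AC]]]] :
    (forall k, k <= size w -> (height w (size w) <= height w k)%R) \/
    exists A C, w = A ++ true :: C /\ first_min A C.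
- by have := H k0 k0w; lia.
- exists A, C; split=> //; rewrite wE in k0w k0c.
  have := first_min_ge_up AC k0w; lia.
elim/last_ind: w {k0 k0w k0c wc} => [|w x IHw].
  by left=> -[|//] _; rewrite height0.
case: IHw => [H|[A [C [wE AC]]]].
  case: x.
    right; exists w, [::]; rewrite cats1; split=> //; split=> // -[|//] _.
  left=> k; rewrite size_rcons leq_eqVlt => /predU1P[->//|kw].
  rewrite (height_rcons _ kw); apply: le_trans (H _ kw).
  by rewrite -(size_rcons w false) !height_size -cats1 !count_cat /=; lia.
have [h0|h0] := leP 0%R (height (rcons C x) (size C).+1).
  right; exists A, (rcons C x); rewrite wE rcons_cat; split=> //.
  case: AC => HA HC; split=> // k; rewrite size_rcons leq_eqVlt => /predU1P[->//|kw].
  by rewrite height_rcons //; apply: HC.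
(* The path returns to its minimal level, so its endpoint is minimal again. *)
case: (AC) => HA HC; have hC := HC (size C) (leqnn _).
left=> k; rewrite size_rcons leq_eqVlt => /predU1P[->//|kw].
rewrite (height_rcons _ kw) wE; rewrite wE in kw.
apply: le_trans (first_min_ge_up AC kw).
rewrite -(size_rcons C x) -(size_rcons (_ ++ _) x) !height_size in h0 hC *.
rewrite -!cats1 !count_cat /= in h0 hC *.
by case: x h0 => /=; lia.
Qed.

(** The rightmost minimum is unique. If [A] were shorter than [A2], then [A2] would end after the U
    step that follows [A], hence strictly above its own vertex at the end of [A]. *)
Lemma first_min_inj A C A2 C2 :
  first_min A C -> first_min A2 C2 -> A ++ true :: C = A2 ++ true :: C2 ->
  A = A2 /\ C = C2.
Proof.
wlog sA : A C A2 C2 / size A <= size A2.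
  move=> H AC AC2 E; case: (leqP (size A) (size A2)) => [|/ltnW] s.
    exact: H.
  by have [] := H _ _ _ _ s AC2 AC (esym E).
move=> [HA HC] [HA2 HC2] E.
move: sA; rewrite leq_eqVlt => /predU1P[sA|sA].
  by move/eqP: E; rewrite eqseq_cat // => /andP[/eqP-> /eqP[->]].
have A2E : A2 = A ++ true :: take (size A2 - (size A).+1) C.
  have := congr1 (take (size A2)) E; rewrite [in RHS]take_size_cat // => E2.
  rewrite -[LHS]E2 take_cat ltnNge ltnW //= -[in LHS](subnSK sA) /=.
  by [].
set j := size A2 - _ in A2E.
have jC : j <= size C.
  by have := congr1 size E; rewrite !size_cat /= /j; lia.
have hA : height A2 (size A) = height A (size A) by rewrite A2E height_cat.
have hA2 : height A2 (size A2) = (height A (size A) + (1 + height C j))%R.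
  have -> : height C j = height (take j C) (size (take j C)).
    by rewrite /height take_size.
  rewrite -(height_cons true) -height_catr; clearbody j; subst A2.
  by rewrite size_cat.
by have := HA2 (size A) (ltnW sA); rewrite hA hA2; have := HC j jC; lia.
Qed.

(** * The commuting square *)

Lemma rev_negbK w : rev (map negb (rev (map negb w))) = w.
Proof. by rewrite map_rev revK -map_comp map_id_in // => -[]. Qed.

(** The minimum is below [c] and the endpoint is not, so a step follows the minimum, and it must be
    U. *)
Lemma valley_exists c w : (c <= 0)%R -> (c <= height w (size w))%R -> A_bar c w ->
  exists A B, [/\ w = A ++ false :: true :: B, first_min A (true :: B)
                & (height A (size A) - 1 < c)%R].
Proof.
move=> c0 cw /(first_min_exists c0)[A [C [wE mC Ac]]].
case: C => [|x C] in wE mC *.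
  move: cw; rewrite wE; have := height_first_min A [::].
  by rewrite size_cat addn1 => ->; lia.
case: x wE mC => wE mC; first by exists A, C.
by case: mC => _ /(_ 1 isT); rewrite height_cons height0.
Qed.

(** [M] is empty if [A] is. Otherwise [A] is some [A'] followed by 2, and [M] is 2 followed by
    [foata A']. *)
Lemma foata_first_min A C : first_min A C -> exists M,
  foata (rcons (rcons A false) true) = M ++ [:: false; true] /\
  foata (rcons (rcons A true) true) = true :: rcons M true.
Proof.
move=> mC; case/lastP: A mC => [|A x] mC; first by exists [::].
have [|A' /rcons_inj[-> ->]] := first_min_last mC; first by case: (A).
exists (false :: foata A'); rewrite foata_rcons21 foata_rcons2.
by rewrite foata_rcons11 foata_rcons21 -[[:: false; true]]cat1s catA !cats1.
Qed.

(** The valley moves one place to the left because [A] ends in 2; if [A] is empty, a valley at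
    x-coordinate 1 disappears. The valleys further right form the same list [X] for both paths. *)
Lemma maj_first_min A B : first_min A (true :: B) ->
  maj (A ++ false :: true :: B) = (maj (A ++ true :: true :: B)).+1.
Proof.
move=> AB; have [L [R [X [_ _ _ E]]]] := foata_cat_up (size A).+1 B.
have [_ E1] := E (rcons A false) (size_rcons _ _).
have [_ E2] := E (rcons A true) (size_rcons _ _).
rewrite !cat_rcons in E1 E2; rewrite !maj_valleys E1 E2 !valleys_rcons.
rewrite !last_rcons /= !sumn_cat /= size_rcons.
case/lastP: A AB {E E1 E2} => [|A x] AB; first by rewrite /= addn1 addn0.
have [|A' /rcons_inj[-> ->]] := first_min_last AB; first by case: (A).
by rewrite last_rcons valleys_rcons /= size_rcons; lia.
Qed.

(** With [i] the size of [X] plus 1, the 2 in L M 2 1 R has [i] letters 1 to its right, so in the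
    conjugate it closes a part of size [i]. As [L] has [i - 1] letters 2, inserting a part of that
    size puts a 1 right after [L]. *)
Lemma fmap_first_min A B : first_min A (true :: B) ->
  fmap (conjp (phi (A ++ false :: true :: B))) =
  conjp (phi (A ++ true :: true :: B)).
Proof.
move=> AB; have [L [R [X [sL sR nX E]]]] := foata_cat_up (size A).+1 B.
have [F1 V1] := E (rcons A false) (size_rcons _ _).
have [F2 _] := E (rcons A true) (size_rcons _ _).
have [M [M1 M2]] := foata_first_min AB.
rewrite !cat_rcons in F1 F2 V1; rewrite M1 in F1; rewrite M2 in F2.
rewrite valleys_rcons last_rcons /= valleys_rcons /= size_rcons in V1.
have iE : min_rank_index (conjp (phi (A ++ false :: true :: B))) = (size X).+1.
  apply: (min_rank_index_phi V1) => k kV; rewrite height_first_min.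
    apply: (first_min_ge AB); apply: ltnW.
    have /mem_valleys/andP[] // : k \in valleys (A ++ false :: true :: B).
    by rewrite V1 mem_cat kV.
  have /andP[_ kA] := mem_valleys kV; rewrite height_cat; last by lia.
  by case: AB => /(_ k (ltnW kA)); lia.
(* The rank at this index is the final height of [A], which is at most 0, so [fmap] acts. *)
rewrite /fmap iE ifT; last first.
  apply/hasP; exists (size X).+1.
    by rewrite mem_iota durfee_conjp_phi V1 size_cat /=; lia.
  rewrite rank_conjp_phi ?V1 ?size_cat /=; last by lia.
  rewrite nth_cat ltnn subnn /= height_first_min.
  by have := first_min_le0 AB; lia.
rewrite /phi F1 F2 [in LHS]conjp_part_of_word.
have -> : rev (map negb (L ++ (M ++ [:: false; true]) ++ R)) =
    rcons (rev (map negb R)) false ++ true :: rev (map negb (L ++ M)).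
  by rewrite !map_cat !rev_cat -cats1 -!catA.
have cR : (size X).+1 = count_mem false (rcons (rev (map negb R)) false).
  by rewrite -cats1 count_cat count_false_conj -sR addn1.
rewrite [in rem _ _]cR rem_part_of_word -?cR // conjp_part_of_word.
have -> :
    rev (map negb
      (rcons (rev (map negb R)) false ++ rev (map negb (L ++ M)))) =
    L ++ (M ++ true :: R).
  by rewrite map_cat rev_cat rev_negbK map_rcons rev_rcons rev_negbK -catA.
rewrite /= sL insert_part_of_word; congr (conjp (part_of_word _)).
by rewrite -cats1 /= -!catA.
Qed.

(** Applying [gamma] raises the endpoint by 2, and the end of [A] remains as a vertex below the
    level raised by 1, so both hypotheses pass on to the next step. *)
Lemma iter_fmap_gamma l w :
  (- l%:Z <= height w (size w))%R -> A_bar (- l%:Z)%R w ->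
  iter l.+1 fmap (conjp (phi w)) = conjp (phi (iter l.+1 gamma w)).
Proof.
elim: l w => [|l IHl] w wl wA.
  have [//|A [B [-> AB _]]] := valley_exists _ wl wA.
  by rewrite /= fmap_first_min // gamma_first_min.
have [|A [B [wE AB Al]]] := valley_exists _ wl wA; first by lia.
rewrite iterSr [in RHS]iterSr wE fmap_first_min // gamma_first_min //.
apply: IHl.
  move: wl; rewrite wE !height_size !count_cat /=; lia.
exists (size A); first by rewrite size_cat; lia.
by rewrite height_cat //; lia.
Qed.

(** * Bijectivity of the sides of the diagram *)

Local Open Scope classical_set_scope.
Local Open Scope ring_scope.

(** The bound [c <= a - b] keeps the endpoint high enough for the changed step to be followed by a U
    step, both in the source and in the target. *)
Lemma gamma_bij (c a b N : int) : c <= 0 -> c <= a - b ->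
  set_bij (A_bar c `&` G a b `&` major N)
    (A_bar (c + 1) `&` G (a + 1) (b - 1) `&` major (N - 1)) gamma.
Proof.
move=> c0 cab.
have split_w w : (A_bar c `&` G a b `&` major N) w ->
    exists A B, [/\ w = A ++ false :: true :: B, first_min A (true :: B)
                & (height A (size A) - 1 < c)%R].
  by move=> [[wA [aE bE]] _]; apply: valley_exists; rewrite // height_size aE bE.
split.
- move=> w wT; have [A [B [wE AB Ac]]] := split_w _ wT.
  move: wT => [[_ [aE bE]] NE]; rewrite wE gamma_first_min //.
  rewrite wE !count_cat /= in aE bE NE; rewrite /major /= maj_first_min // in NE.
  split; [split|].
  + by exists (size A); [rewrite size_cat; lia|rewrite height_cat //; lia].
  + by split; rewrite !count_cat /=; lia.
  + by rewrite /major /=; lia.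
- move=> w w2 /set_mem/split_w[A [B [-> AB _]]] /set_mem/split_w[A2 [B2 [-> AB2 _]]].
  by rewrite !gamma_first_min // => /(first_min_inj AB AB2)[-> [->]].
move=> w [[wA [aE bE]] NE].
have [|A [C [wE mC Ac]]] := first_min_exists_up wA.
  by rewrite height_size aE bE; lia.
(* With [C] empty the endpoint would have height at most [c + 1], but it is at least [c + 2]. *)
case: C wE mC => [|x C] wE mC.
  move: aE bE; rewrite wE !count_cat /= => aE bE.
  by move: Ac; rewrite height_size /=; lia.
case: x wE mC => wE mC; last first.
  by case: mC => _ /(_ 1 isT); rewrite height_cons height0.
exists (A ++ false :: true :: C); last by rewrite gamma_first_min.
rewrite wE !count_cat /= in aE bE; rewrite /major /= wE in NE.
split; [split|].
+ exists (size A).+1; first by rewrite size_cat /=; lia.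
  by rewrite height_first_min.
+ by split; rewrite !count_cat /=; lia.
+ by rewrite /major /= maj_first_min //; lia.
Qed.

(** [c + k <= 1] makes every single step start from a level at most 0. The other bound persists, as
    each step adds 1 to the level and 2 to [a - b]. *)
Lemma iter_gamma_bij (k : nat) (c a b N : int) :
  c + k%:Z <= 1 -> c <= a - b ->
  set_bij (A_bar c `&` G a b `&` major N)
    (A_bar (c + k%:Z) `&` G (a + k%:Z) (b - k%:Z) `&` major (N - k%:Z))
    (iter k gamma).
Proof.
elim: k c a b N => [|k IHk] c a b N ck cab.
  by rewrite !addr0; split=> [w|w w2|w Tw] //; exists w.
apply: (@eq_set_bijRL _ _ _ _ (iter k gamma \o gamma)) => [w _|].
  by rewrite iterSr.
apply: (@set_bij_comp _ _ _ _
    (A_bar (c + 1) `&` G (a + 1) (b - 1) `&` major (N - 1))).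
  by apply: gamma_bij; lia.
have := IHk (c + 1) (a + 1) (b - 1) (N - 1).
have -> : c + 1 + k%:Z = c + k.+1%:Z by lia.
have -> : a + 1 + k%:Z = a + k.+1%:Z by lia.
have -> : b - 1 - k%:Z = b - k.+1%:Z by lia.
have -> : N - 1 - k%:Z = N - k.+1%:Z by lia.
by apply; lia.
Qed.

Lemma conjp_Pbox (a b : int) lam : Pbox a b lam -> Pbox b a (conjp lam).
Proof.
case=> lamP a0 b0 sl l1; split=> //; first exact: conjp_is_partition.
  by rewrite size_conjp.
by rewrite part_conjp1.
Qed.

Lemma durfee_conjp lam : is_partition lam -> durfee (conjp lam) = durfee lam.
Proof.
move=> /part_of_word_surj[w ->]; have := durfee_conjp_phi (foata_inv w).
by rewrite -durfee_phi /phi foata_invK.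
Qed.

Lemma weight_conjp N lam :
  is_partition lam -> weight N lam -> weight N (conjp lam).
Proof. by move=> lamP; rewrite /weight /= sumn_conjp. Qed.

Lemma set_bij_can T U (A : set T) (B : set U) (f : T -> U) g :
    (forall x, A x -> B (f x)) -> (forall y, B y -> A (g y)) ->
    (forall x, A x -> g (f x) = x) -> (forall y, B y -> f (g y) = y) ->
  set_bij A B f.
Proof.
move=> fP gP fK gK; split=> // [x y|y By].
  by move=> /set_mem/fK {2}<- /set_mem/fK {2}<- ->.
by exists (g y); [exact: gP|exact: gK].
Qed.

Lemma conjp_bij (a b N : int) :
  set_bij (Pbox a b `&` weight N) (Pbox b a `&` weight N) conjp.
Proof.
apply: (@set_bij_can _ _ _ _ _ conjp) => lam [lamP lamN].
- by split; [exact: conjp_Pbox|apply: weight_conjp => //; case: lamP].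
- by split; [exact: conjp_Pbox|apply: weight_conjp => //; case: lamP].
- by apply: conjpK; case: lamP.
- by apply: conjpK; case: lamP.
Qed.

Lemma conjp_rank_bij (c a b N : int) :
  set_bij (Rge_bar (- c) `&` Pbox a b `&` weight N)
          (Rle_bar c `&` Pbox b a `&` weight N) conjp.
Proof.
apply: (@set_bij_can _ _ _ _ _ conjp) => lam [[[lamP [i [i0 il ri]]] lamB] lamN].
- split; [split|exact: weight_conjp]; last exact: conjp_Pbox.
  split; first exact: conjp_is_partition.
  by exists i; rewrite durfee_conjp // rank_conjp //; split=> //; lia.
- split; [split|exact: weight_conjp]; last exact: conjp_Pbox.
  split; first exact: conjp_is_partition.
  by exists i; rewrite durfee_conjp // rank_conjp //; split=> //; lia.
- exact: conjpK.
- exact: conjpK.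
Qed.

(** Ranks above [- c - 1] are valleys below height [c]. Conversely, a path going below [c] and
    ending at or above it has its lowest vertex at a valley. *)
Lemma Rle_bar_phi (c : int) w :
  c <= 0 -> c <= height w (size w) ->
  Rle_bar (- c - 1) (phi w) <-> A_bar c w.
Proof.
move=> c0 cw; split=> [[_ [i [i0]]]|wA].
  rewrite durfee_phi => iw; have [_ ->//] := rank_phi w i0 => ri.
  have iv : (0 < i <= size (valleys w))%N by rewrite i0.
  have /andP[_ kw] := nth_valleys iv.
  by exists (nth 0%N (valleys w) i.-1); [exact: ltnW|lia].
have [A [B [wE AB Ac]]] := valley_exists c0 cw wA.
have vA : (size A).+1 \in valleys w.
  rewrite wE mem_rev mem_filter mem_index_iota size_cat /= /valley /=.
  by rewrite !nth_cat ltnn subnn ltnNge leqnSn subSnn /=; lia.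
split=> //; exists (index (size A).+1 (valleys w)).+1.
rewrite durfee_phi index_mem; split=> //.
have [_ ->] := rank_phi w (ltn0Sn (index (size A).+1 (valleys w))).
  by rewrite nth_index // wE height_first_min; lia.
by rewrite index_mem.
Qed.

Lemma phi_inv_bij (a b : nat) (N : int) :
  set_bij (Pbox a b `&` weight N) (G a b `&` major N) (phi_inv a b) /\
  set_bij (G a b `&` major N) (Pbox a b `&` weight N) phi.
Proof.
have inG lam : (Pbox a b `&` weight N) lam ->
    (G a b `&` major N) (phi_inv a b lam).
  move=> [lamB lamN]; split; first exact: phi_inv_G.
  by move: lamN; rewrite /major /weight /= -sumn_phi phi_invK.
have inP w : (G a b `&` major N) w -> (Pbox a b `&` weight N) (phi w).
  move=> [wG wN]; split; first exact: phi_Pbox.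
  by move: wN; rewrite /major /weight /= -sumn_phi.
split; [apply: (set_bij_can inG inP) | apply: (set_bij_can inP inG)].
- by move=> lam [/phi_invK].
- by move=> w [/phiK].
- by move=> w [/phiK].
- by move=> lam [/phi_invK].
Qed.

Lemma phi_inv_rank_bij (c : int) (a b : nat) (N : int) :
  c <= 0 -> c <= a%:Z - b%:Z ->
  set_bij (Rle_bar (- c - 1) `&` Pbox a b `&` weight N)
          (A_bar c `&` G a b `&` major N) (phi_inv a b).
Proof.
move=> c0 cab; have Gc w : G a b w -> c <= height w (size w).
  by case=> aE bE; rewrite height_size aE bE.
apply: (@set_bij_can _ _ _ _ _ phi) => w [[wR wB] wN].
- have wG := phi_inv_G wB; split; last first.
    by move: wN; rewrite /major /weight /= -sumn_phi phi_invK.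
  by split=> //; apply/Rle_bar_phi; rewrite ?phi_invK //; exact: Gc.
- split; last by move: wN; rewrite /major /weight /= -sumn_phi.
  split; last exact: phi_Pbox.
  by apply/Rle_bar_phi => //; exact: Gc.
- exact: phi_invK.
- exact: phiK.
Qed.

Theorem corollary6p6 (m n l N : nat) (hml : (m <= n + l)%N) :
  let theta := iter l.+1 fmap in
  let gammal := iter l.+1 gamma in
  let phi_top := phi_inv n m in
  let phi_bot := phi_inv (n + l + 1)%N (m - l - 1)%N in
  let TL := Rge_bar (1 - l%:Z) `&` Pbox m%:Z n%:Z `&` weight N%:Z in
  let TM := Rle_bar (l%:Z - 1) `&` Pbox n%:Z m%:Z `&` weight N%:Z in
  let TR := A_bar (- l%:Z) `&` G n%:Z m%:Z `&` major N%:Z in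
  let BL := Pbox (m%:Z - l%:Z - 1) (n%:Z + l%:Z + 1)
              `&` weight (N%:Z - l%:Z - 1) in
  let BM := Pbox (n%:Z + l%:Z + 1) (m%:Z - l%:Z - 1)
              `&` weight (N%:Z - l%:Z - 1) in
  let BR := G (n%:Z + l%:Z + 1) (m%:Z - l%:Z - 1)
              `&` major (N%:Z - l%:Z - 1) in
  [/\ forall lam, TL lam ->
        theta lam = conjp (phi (gammal (phi_top (conjp lam)))),
      [/\ set_bij TL TM conjp, set_bij TM TR phi_top & set_bij TR BR gammal]
    & [/\ set_bij TL BL theta, set_bij BL BM conjp & set_bij BM BR phi_bot]].
Proof.
move=> theta gammal phi_top phi_bot TL TM TR BL BM BR.
have TLM : set_bij TL TM conjp.
  by have := conjp_rank_bij (l%:Z - 1) m n N; rewrite opprB.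
have TMR : set_bij TM TR phi_top.
  by have := @phi_inv_rank_bij (- l%:Z) n m N; rewrite opprK; apply; lia.
have TRB : set_bij TR BR gammal.
  have := @iter_gamma_bij l.+1 (- l%:Z) n m N.
  have -> : - l%:Z + l.+1%:Z = 1 by lia.
  have -> : n%:Z + l.+1%:Z = n%:Z + l%:Z + 1 by lia.
  have -> : m%:Z - l.+1%:Z = m%:Z - l%:Z - 1 by lia.
  have -> : N%:Z - l.+1%:Z = N%:Z - l%:Z - 1 by lia.
  (* The origin lies below the line [y = 1], so the last level imposes no condition. *)
  have -> : A_bar 1 = setT.
    by apply/seteqP; split=> // w _; exists 0%N; rewrite // height0.
  by rewrite setTI; apply; lia.
have BLM : set_bij BL BM conjp by exact: conjp_bij.
have [BMR BRM] : set_bij BM BR phi_bot /\ set_bij BR BM phi.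
  (* When [m <= l] the subtraction in [phi_bot] is truncated, but both sets are then empty, as the
     integer box has a negative side. *)
  have [lm|ml] := leqP l.+1 m.
    have := @phi_inv_bij (n + l + 1) (m - l - 1) (N%:Z - l%:Z - 1).
    have -> : (n + l + 1)%N%:Z = n%:Z + l%:Z + 1 by lia.
    by have -> : (m - l - 1)%N%:Z = m%:Z - l%:Z - 1 by lia.
  have -> : BM = set0 by apply/seteqP; split=> // lam [[_ _]]; lia.
  have -> : BR = set0 by apply/seteqP; split=> // w [[_]]; lia.
  by split; exact: set_bij00.
have comm lam : TL lam ->
    theta lam = conjp (phi (gammal (phi_top (conjp lam)))).
  move=> lamT; have [TM1 _ _] := TLM; have [TR1 _ _] := TMR.
  have TMl := TM1 _ lamT; have [[wA [aE bE]] _] := TR1 _ TMl.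
  rewrite -iter_fmap_gamma ?height_size ?aE ?bE //; last by lia.
  case: TMl => -[_ /phi_invK->] _.
  by case: lamT => -[_ [lamP _ _ _ _]] _; rewrite conjpK.
split=> //; split=> //.
(* By commutativity [theta] is the composite of the other sides, hence bijective. *)
apply: (eq_set_bijLR (g := conjp \o phi \o gammal \o phi_top \o conjp)).
  by move=> lam /set_mem/comm.
apply: set_bij_comp TLM _; apply: set_bij_comp TMR _; apply: set_bij_comp TRB _.
exact: set_bij_comp BRM (conjp_bij _ _ _).
Qed.
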